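(* Let $T$ be an $\omega$-consistent theory and let $\sigma$ be a $\Sigma_3$-sentence that is true in the standard model $\mathbb{N}$. Then the theory $T+\sigma$ is $\omega$-consistent and the theory $T+\neg\sigma$ is $\omega$-inconsistent.
   Context: Fix a sufficiently strong, sound arithmetical base theory $\mathbb{P}$ (e.g. Peano Arithmetic, or a fragment such as $\mathrm{I}\Sigma_1$) in a language containing $+,\times$; $\mathbb{P}$ proves every true $\Sigma_1$-sentence. Throughout, a ''theory'' is a set of arithmetical sentences containing $\mathbb{P}$. For $n\in\mathbb{N}$, $\overline{n}$ denotes the standard numeral of $n$. A theory $T$ is $\omega$-consistent if there is no formula $\varphi(x)$ with only $x$ free such that $T\vdash\neg\forall x\,\varphi(x)$ and $T\vdash\varphi(\overline{n})$ for every $n\in\mathbb{N}$; otherwise it is $\omega$-inconsistent. *)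

(* Defs.v *)
(* First-order arithmetic in the language {0, S, +, *, <} with equality. *)
From Stdlib Require Import List Arith.
Import ListNotations.

(** * Syntax, with de Bruijn indices *)

Inductive term : Type :=
| tVar (n : nat)
| tZero
| tSucc (t : term)
| tAdd (t u : term)
| tMul (t u : term).

Inductive form : Type :=
| fBot
| fEq (t u : term)
| fLt (t u : term)
| fImp (A B : form)
| fAnd (A B : form)
| fOr (A B : form)
| fAll (A : form)
| fEx (A : form).

Definition fNot (A : form) : form := fImp A fBot.

Fixpoint subst_term (s : nat -> term) (t : term) : term :=
  match t with
  | tVar n => s n
  | tZero => tZero
  | tSucc t => tSucc (subst_term s t)
  | tAdd t u => tAdd (subst_term s t) (subst_term s u)
  | tMul t u => tMul (subst_term s t) (subst_term s u)
  end.

Definition shift (n : nat) : term := tVar (S n).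

Definition up (s : nat -> term) (n : nat) : term :=
  match n with
  | 0 => tVar 0
  | S m => subst_term shift (s m)
  end.

Fixpoint subst (s : nat -> term) (A : form) : form :=
  match A with
  | fBot => fBot
  | fEq t u => fEq (subst_term s t) (subst_term s u)
  | fLt t u => fLt (subst_term s t) (subst_term s u)
  | fImp A B => fImp (subst s A) (subst s B)
  | fAnd A B => fAnd (subst s A) (subst s B)
  | fOr A B => fOr (subst s A) (subst s B)
  | fAll A => fAll (subst (up s) A)
  | fEx A => fEx (subst (up s) A)
  end.

Definition lift_term : term -> term := subst_term shift.
Definition lift : form -> form := subst shift.

(* [inst A t] is A(t), the body [A] of a quantifier applied to [t]: variable 0
   is replaced by [t] and the remaining free variables are lowered by one. *)
Definition inst (A : form) (t : term) : form :=
  subst (fun n => match n with 0 => t | S m => tVar m end) A.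

Fixpoint numeral (n : nat) : term :=
  match n with
  | 0 => tZero
  | S m => tSucc (numeral m)
  end.

Fixpoint term_fv_below (k : nat) (t : term) : Prop :=
  match t with
  | tVar n => n < k
  | tZero => True
  | tSucc t => term_fv_below k t
  | tAdd t u | tMul t u => term_fv_below k t /\ term_fv_below k u
  end.

(* All free variables of the formula have index less than [k]. *)
Fixpoint fv_below (k : nat) (A : form) : Prop :=
  match A with
  | fBot => True
  | fEq t u | fLt t u => term_fv_below k t /\ term_fv_below k u
  | fImp A B | fAnd A B | fOr A B => fv_below k A /\ fv_below k B
  | fAll A | fEx A => fv_below (S k) A
  end.

Definition sentence (A : form) : Prop := fv_below 0 A.

(** * Provability: classical natural deduction with equality *)

Inductive nd : list form -> form -> Prop :=
| nd_hyp G A : In A G -> nd G A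
| nd_raa G A : nd (fNot A :: G) fBot -> nd G A
| nd_impI G A B : nd (A :: G) B -> nd G (fImp A B)
| nd_impE G A B : nd G (fImp A B) -> nd G A -> nd G B
| nd_andI G A B : nd G A -> nd G B -> nd G (fAnd A B)
| nd_andE1 G A B : nd G (fAnd A B) -> nd G A
| nd_andE2 G A B : nd G (fAnd A B) -> nd G B
| nd_orI1 G A B : nd G A -> nd G (fOr A B)
| nd_orI2 G A B : nd G B -> nd G (fOr A B)
| nd_orE G A B C :
    nd G (fOr A B) -> nd (A :: G) C -> nd (B :: G) C -> nd G C
| nd_allI G A : nd (map lift G) A -> nd G (fAll A)
| nd_allE G A t : nd G (fAll A) -> nd G (inst A t)
| nd_exI G A t : nd G (inst A t) -> nd G (fEx A)
| nd_exE G A C : nd G (fEx A) -> nd (A :: map lift G) (lift C) -> nd G C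
| nd_eq_refl G t : nd G (fEq t t)
| nd_eq_subst G A t u : nd G (fEq t u) -> nd G (inst A t) -> nd G (inst A u).

Definition proves (T : form -> Prop) (A : form) : Prop :=
  exists G : list form, (forall B, In B G -> T B) /\ nd G A.

(** * The standard model *)

Fixpoint eval (e : nat -> nat) (t : term) : nat :=
  match t with
  | tVar n => e n
  | tZero => 0
  | tSucc t => S (eval e t)
  | tAdd t u => eval e t + eval e u
  | tMul t u => eval e t * eval e u
  end.

Definition scons (a : nat) (e : nat -> nat) (n : nat) : nat :=
  match n with
  | 0 => a
  | S m => e m
  end.

Fixpoint sat (e : nat -> nat) (A : form) : Prop :=
  match A with
  | fBot => False
  | fEq t u => eval e t = eval e u
  | fLt t u => eval e t < eval e u
  | fImp A B => sat e A -> sat e B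
  | fAnd A B => sat e A /\ sat e B
  | fOr A B => sat e A \/ sat e B
  | fAll A => forall a, sat (scons a e) A
  | fEx A => exists a, sat (scons a e) A
  end.

Definition true_in_N (A : form) : Prop := forall e : nat -> nat, sat e A.

(** * The arithmetical hierarchy *)

(* In the bounded quantifiers the bound [t] is lifted, so that it does not
   contain the quantified variable. *)
Inductive Delta0 : form -> Prop :=
| D0_bot : Delta0 fBot
| D0_eq t u : Delta0 (fEq t u)
| D0_lt t u : Delta0 (fLt t u)
| D0_imp A B : Delta0 A -> Delta0 B -> Delta0 (fImp A B)
| D0_and A B : Delta0 A -> Delta0 B -> Delta0 (fAnd A B)
| D0_or A B : Delta0 A -> Delta0 B -> Delta0 (fOr A B)
| D0_all t A :
    Delta0 A -> Delta0 (fAll (fImp (fLt (tVar 0) (lift_term t)) A))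
| D0_ex t A :
    Delta0 A -> Delta0 (fEx (fAnd (fLt (tVar 0) (lift_term t)) A)).

(* Prenex classes with n alternating, possibly empty, blocks of quantifiers in
   front of a bounded formula, the first block being existential for [Sigma]
   and universal for [Pi]. *)
Inductive Sigma : nat -> form -> Prop :=
| Sigma_0 A : Delta0 A -> Sigma 0 A
| Sigma_Pi n A : Pi n A -> Sigma (S n) A
| Sigma_ex n A : Sigma (S n) A -> Sigma (S n) (fEx A)
with Pi : nat -> form -> Prop :=
| Pi_0 A : Delta0 A -> Pi 0 A
| Pi_Sigma n A : Sigma n A -> Pi (S n) A
| Pi_all n A : Pi (S n) A -> Pi (S n) (fAll A).

(** * Theories *)

Definition fLe (t u : term) : form := fOr (fLt t u) (fEq t u).

(* The theory PA^- of the nonnegative parts of discretely ordered rings, with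
   1 rendered as S 0. It is contained in the deductive closures of PA, of
   I Sigma_1 and of I Delta_0. *)
Definition PAminus : list form :=
  let x := tVar 0 in let y := tVar 1 in let z := tVar 2 in
  let one := tSucc tZero in
  let all2 A := fAll (fAll A) in
  let all3 A := fAll (fAll (fAll A)) in
  [ fAll (fEq (tSucc x) (tAdd x one));
    all3 (fEq (tAdd (tAdd x y) z) (tAdd x (tAdd y z)));
    all2 (fEq (tAdd x y) (tAdd y x));
    all3 (fEq (tMul (tMul x y) z) (tMul x (tMul y z)));
    all2 (fEq (tMul x y) (tMul y x));
    all3 (fEq (tMul x (tAdd y z)) (tAdd (tMul x y) (tMul x z)));
    fAll (fEq (tAdd x tZero) x);
    fAll (fEq (tMul x tZero) tZero);
    fAll (fEq (tMul x one) x);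
    all3 (fImp (fAnd (fLt x y) (fLt y z)) (fLt x z));
    fAll (fNot (fLt x x));
    all2 (fOr (fLt x y) (fOr (fEq x y) (fLt y x)));
    all3 (fImp (fLt x y) (fLt (tAdd x z) (tAdd y z)));
    all3 (fImp (fAnd (fLt tZero z) (fLt x y)) (fLt (tMul x z) (tMul y z)));
    all2 (fImp (fLt x y)
               (fEx (fEq (tAdd (lift_term x) (tVar 0)) (lift_term y))));
    fLt tZero one;
    fAll (fImp (fLt tZero x) (fLe one x));
    fAll (fLe tZero x) ].

(* [bt_PAminus] makes "sufficiently strong" precise; PA and I Sigma_1 are
   instances. *)
Record base_theory (P : form -> Prop) : Prop := {
  bt_sentences : forall A, P A -> sentence A;
  bt_sound : forall A, P A -> true_in_N A;
  bt_PAminus : forall A, In A PAminus -> proves P A;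
  bt_Sigma1_complete :
    forall A, sentence A -> Sigma 1 A -> true_in_N A -> proves P A
}.

Record theory_over (P T : form -> Prop) : Prop := {
  th_sentences : forall A, T A -> sentence A;
  th_contains : forall A, P A -> T A
}.

Definition adjoin (T : form -> Prop) (A : form) : form -> Prop :=
  fun B => T B \/ B = A.

Definition omega_inconsistent (T : form -> Prop) : Prop :=
  exists A : form,
    fv_below 1 A /\
    proves T (fNot (fAll A)) /\
    forall n : nat, proves T (inst A (numeral n)).

Definition omega_consistent (T : form -> Prop) : Prop :=
  ~ omega_inconsistent T.

(* Main.v *)
(** For a true Sigma_3 sentence [sigma] there is a formula B(w) such that the
    base theory proves B(n) for every [n] and proves that (forall w, B(w))
    implies [sigma]. To find it, replace the leading existential quantifiers
    of [sigma] by true numerical witnesses and bound the following universal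
    block by [w]; each B(n) then amounts to finitely many true Sigma_1
    sentences.

    Hence the negation of [sigma] refutes (forall w, B(w)), which makes
    [T] + not [sigma] omega-inconsistent. If some phi witnesses that
    [T] + [sigma] is omega-inconsistent, then B(x) /\ (sigma -> phi(x))
    witnesses that [T] is. *)
Require Import Defs.
From Stdlib Require Import List Arith Lia.
Import ListNotations.

(** * Substitution *)

Definition tscons (t : term) (s : nat -> term) (n : nat) : term :=
  match n with
  | 0 => t
  | S m => s m
  end.

Lemma term_fv_below_eventually t :
  exists k0, forall k, k0 <= k -> term_fv_below k t.
Proof.
  induction t as [n| |t IH|t [a IHa] u [b IHb]|t [a IHa] u [b IHb]]; simpl.
  - exists (S n); lia.
  - now exists 0.
  - exact IH.
  - exists (a + b); split; [apply IHa|apply IHb]; lia.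
  - exists (a + b); split; [apply IHa|apply IHb]; lia.
Qed.

(** Only finitely many variables occur in a formula, so facts proved for variables below a bound
    yield unrestricted ones. *)
Lemma fv_below_eventually A : exists k0, forall k, k0 <= k -> fv_below k A.
Proof.
  induction A as [|t u|t u|A [a IHa] B [b IHb]|A [a IHa] B [b IHb]
                 |A [a IHa] B [b IHb]|A [a IHa]|A [a IHa]]; simpl;
    try (destruct (term_fv_below_eventually t) as [a Ha];
         destruct (term_fv_below_eventually u) as [b Hb];
         exists (a + b); split; [apply Ha|apply Hb]; lia);
    try (exists (a + b); split; [apply IHa|apply IHb]; lia);
    try (exists a; intros; apply IHa; lia).
  now exists 0.
Qed.

Lemma subst_term_ext_below k t s r :
  term_fv_below k t -> (forall n, n < k -> s n = r n) ->
  subst_term s t = subst_term r t.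
Proof.
  intros Ht Hsr; induction t; simpl in *; f_equal; intuition auto.
Qed.

Lemma up_ext_below k s r :
  (forall n, n < k -> s n = r n) -> forall n, n < S k -> up s n = up r n.
Proof.
  intros H [|n] Hn; simpl; [easy|rewrite H; [easy|lia]].
Qed.

Lemma subst_ext_below A : forall k s r,
  fv_below k A -> (forall n, n < k -> s n = r n) -> subst s A = subst r A.
Proof.
  induction A; intros k s r HA Hsr; simpl in *; f_equal;
    intuition eauto using subst_term_ext_below, up_ext_below.
Qed.

Lemma subst_term_ext t s r :
  (forall n, s n = r n) -> subst_term s t = subst_term r t.
Proof.
  intros H; destruct (term_fv_below_eventually t) as [k Hk].
  apply (subst_term_ext_below k); auto.
Qed.

Lemma subst_ext A s r : (forall n, s n = r n) -> subst s A = subst r A.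
Proof.
  intros H; destruct (fv_below_eventually A) as [k Hk].
  apply (subst_ext_below A k); auto.
Qed.

Lemma subst_term_comp t s r :
  subst_term r (subst_term s t) = subst_term (fun n => subst_term r (s n)) t.
Proof. induction t; simpl; congruence. Qed.

Lemma up_comp s r n :
  subst_term (up r) (up s n) = up (fun m => subst_term r (s m)) n.
Proof.
  destruct n as [|n]; simpl; [easy|].
  rewrite !subst_term_comp; now apply subst_term_ext.
Qed.

Lemma subst_comp A : forall s r,
  subst r (subst s A) = subst (fun n => subst_term r (s n)) A.
Proof.
  induction A; intros s r; simpl; f_equal; auto using subst_term_comp;
    rewrite IHA; apply subst_ext; intros n; apply up_comp.
Qed.

Lemma subst_term_var t : subst_term tVar t = t.
Proof. induction t; simpl; congruence. Qed.

Lemma subst_id A s : (forall n, s n = tVar n) -> subst s A = A.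
Proof.
  revert s; induction A; intros s Hs; simpl; f_equal; auto;
    try (rewrite (subst_term_ext _ s tVar Hs); apply subst_term_var);
    apply IHA; intros [|n]; simpl; [easy|now rewrite Hs|easy|now rewrite Hs].
Qed.

Lemma subst_sentence A s : sentence A -> subst s A = A.
Proof.
  intros HA; rewrite <- (subst_id A tVar) at 2 by easy.
  now apply (subst_ext_below A 0).
Qed.

Lemma subst_term_tscons_lift s t u :
  subst_term (tscons t s) (lift_term u) = subst_term s u.
Proof.
  unfold lift_term; rewrite subst_term_comp; now apply subst_term_ext.
Qed.

Lemma inst_up A s t : inst (subst (up s) A) t = subst (tscons t s) A.
Proof.
  unfold inst; rewrite subst_comp; apply subst_ext; intros [|n]; [easy|].
  simpl; fold (lift_term (s n)).
  rewrite (subst_term_tscons_lift tVar t); apply subst_term_var.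
Qed.

Lemma inst_lift A t : inst (lift A) t = A.
Proof. unfold inst, lift; rewrite subst_comp; now apply subst_id. Qed.

Lemma subst_term_numeral s n : subst_term s (numeral n) = numeral n.
Proof. induction n; simpl; congruence. Qed.

Lemma subst_term_fv_below k j t s :
  term_fv_below k t -> (forall n, n < k -> term_fv_below j (s n)) ->
  term_fv_below j (subst_term s t).
Proof. intros Ht Hs; induction t; simpl in *; intuition auto. Qed.

Lemma up_fv_below k j s :
  (forall n, n < k -> term_fv_below j (s n)) ->
  forall n, n < S k -> term_fv_below (S j) (up s n).
Proof.
  intros Hs [|n] Hn; simpl; [lia|].
  apply (subst_term_fv_below j); [apply Hs; lia|].
  intros i Hi; simpl; lia.
Qed.

Lemma subst_fv_below A : forall k j s,
  fv_below k A -> (forall n, n < k -> term_fv_below j (s n)) ->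
  fv_below j (subst s A).
Proof.
  induction A; intros k j s HA Hs; simpl in *;
    intuition eauto using subst_term_fv_below, up_fv_below.
Qed.

Lemma subst_fv_below_all A j s :
  (forall n, term_fv_below j (s n)) -> fv_below j (subst s A).
Proof.
  intros Hs; destruct (fv_below_eventually A) as [k Hk].
  apply (subst_fv_below A k); auto.
Qed.

(** Closes a formula under an assignment: truth under [e] becomes truth of a sentence, to which
    Sigma_1-completeness can apply. *)
Definition numerals (e : nat -> nat) (n : nat) : term := numeral (e n).

Lemma numeral_fv_below k n : term_fv_below k (numeral n).
Proof. induction n; simpl; auto. Qed.

Lemma subst_numerals_sentence e A : sentence (subst (numerals e) A).
Proof. apply subst_fv_below_all; intros n; apply numeral_fv_below. Qed.

Lemma subst_up_numerals_fv_below A e : fv_below 1 (subst (up (numerals e)) A).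
Proof.
  apply subst_fv_below_all; intros [|n]; simpl; [lia|].
  unfold numerals; rewrite subst_term_numeral; apply numeral_fv_below.
Qed.

(** * Truth and the arithmetical hierarchy *)

Lemma eval_ext e e' t : (forall n, e n = e' n) -> eval e t = eval e' t.
Proof. intros H; induction t; simpl; auto. Qed.

Lemma scons_ext a e e' :
  (forall n, e n = e' n) -> forall n, scons a e n = scons a e' n.
Proof. intros H [|n]; simpl; auto. Qed.

Lemma sat_ext A : forall e e',
  (forall n, e n = e' n) -> (sat e A <-> sat e' A).
Proof.
  induction A; intros e e' H; simpl;
    try rewrite (eval_ext e e' t H), (eval_ext e e' u H);
    try rewrite (IHA1 e e' H), (IHA2 e e' H); try easy.
  - split; intros HA a; apply (IHA _ _ (scons_ext a e e' H)), HA.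
  - split; intros [a HA]; exists a; apply (IHA _ _ (scons_ext a e e' H)), HA.
Qed.

Lemma eval_subst e s t :
  eval e (subst_term s t) = eval (fun n => eval e (s n)) t.
Proof. induction t; simpl; auto. Qed.

Lemma sat_subst A : forall e s,
  sat e (subst s A) <-> sat (fun n => eval e (s n)) A.
Proof.
  assert (Hup : forall a e s n,
    eval (scons a e) (up s n) = scons a (fun m => eval e (s m)) n).
  { intros a e s [|n]; simpl; [easy|].
    rewrite eval_subst; now apply eval_ext. }
  induction A; intros e s; simpl; rewrite ?eval_subst;
    try rewrite IHA1, IHA2; try easy.
  - split; intros H a; specialize (H a); apply IHA in H || apply IHA;
      revert H; apply sat_ext; intros n; now rewrite Hup.
  - split; intros [a H]; exists a; apply IHA in H || apply IHA;
      revert H; apply sat_ext; intros n; now rewrite Hup.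
Qed.

Lemma eval_numeral e n : eval e (numeral n) = n.
Proof. induction n; simpl; auto. Qed.

Lemma true_subst_numerals e A : sat e A -> true_in_N (subst (numerals e) A).
Proof.
  intros H e'; apply sat_subst; revert H; apply sat_ext.
  intros n; unfold numerals; now rewrite eval_numeral.
Qed.

Lemma Delta0_subst A : Delta0 A -> forall s, Delta0 (subst s A).
Proof.
  assert (Hlift : forall s t,
    subst_term (up s) (lift_term t) = lift_term (subst_term s t)).
  { intros s t; unfold lift_term; rewrite !subst_term_comp.
    now apply subst_term_ext. }
  induction 1; intros s; simpl; rewrite ?Hlift; now constructor.
Qed.

Scheme Sigma_mut := Minimality for Sigma Sort Prop
  with Pi_mut := Minimality for Pi Sort Prop.
Combined Scheme Sigma_Pi_ind from Sigma_mut, Pi_mut.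

Lemma Sigma_Pi_subst :
  (forall n A, Sigma n A -> forall s, Sigma n (subst s A)) /\
  (forall n A, Pi n A -> forall s, Pi n (subst s A)).
Proof.
  apply Sigma_Pi_ind; intros; simpl;
    solve [now constructor; auto using Delta0_subst
          |now apply Sigma_ex, H0 | now apply Pi_all, H0].
Qed.

(** * Derivability from a set of sentences *)

Lemma nd_weaken G A : nd G A -> forall G', incl G G' -> nd G' A.
Proof.
  assert (Hcons : forall (B : form) G G', incl G G' -> incl (B :: G) (B :: G')).
  { intros B G1 G2 H; now apply incl_cons; [left|apply incl_tl]. }
  induction 1; intros G' HG;
    solve [econstructor; eauto using incl_map].
Qed.

(** [Gam] holds the local hypotheses, which may have free variables; [G] holds the axioms used,
    which lifting under a quantifier leaves unchanged when [T] consists of sentences. *)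
Definition derives (T : form -> Prop) (Gam : list form) (A : form) : Prop :=
  exists G, (forall B, In B G -> T B) /\ nd (Gam ++ G) A.

Section Derives.

Variable T : form -> Prop.
Hypothesis T_sentences : forall A, T A -> sentence A.

Lemma derives_weaken Gam Gam' A :
  derives T Gam A -> incl Gam Gam' -> derives T Gam' A.
Proof.
  intros (G & HG & H) Hincl; exists G; split; [easy|].
  apply (nd_weaken _ _ H), incl_app; [now apply incl_appl|now apply incl_appr].
Qed.

Lemma derives_proves Gam A : proves T A -> derives T Gam A.
Proof. intros H; now apply (derives_weaken []). Qed.

Lemma derives_nd1 Gam A B :
  (forall G, nd G A -> nd G B) -> derives T Gam A -> derives T Gam B.
Proof. intros HAB (G & HG & H); exists G; auto. Qed.

Lemma derives_common Gam1 Gam2 A B :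
  derives T Gam1 A -> derives T Gam2 B ->
  exists G, (forall C, In C G -> T C) /\ nd (Gam1 ++ G) A /\ nd (Gam2 ++ G) B.
Proof.
  intros (G1 & HG1 & H1) (G2 & HG2 & H2); exists (G1 ++ G2); split.
  { intros C HC; apply in_app_or in HC; destruct HC; auto. }
  split; [apply (nd_weaken _ _ H1)|apply (nd_weaken _ _ H2)];
    intros C HC; rewrite !in_app_iff in *; tauto.
Qed.

Lemma derives_nd2 Gam A B C :
  (forall G, nd G A -> nd G B -> nd G C) ->
  derives T Gam A -> derives T Gam B -> derives T Gam C.
Proof.
  intros HABC HA HB.
  destruct (derives_common _ _ _ _ HA HB) as (G & HG & H1 & H2).
  exists G; auto.
Qed.

Lemma derives_hyp Gam A : In A Gam -> derives T Gam A.
Proof.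
  intros H; exists []; split; [easy|]; apply nd_hyp, in_or_app; now left.
Qed.

Lemma derives_impI Gam A B : derives T (A :: Gam) B -> derives T Gam (fImp A B).
Proof. intros (G & HG & H); exists G; split; [easy|now apply nd_impI]. Qed.

Lemma derives_impE Gam A B :
  derives T Gam (fImp A B) -> derives T Gam A -> derives T Gam B.
Proof. apply derives_nd2; intros G; apply nd_impE. Qed.

Lemma derives_exfalso Gam A : derives T Gam fBot -> derives T Gam A.
Proof.
  apply derives_nd1; intros G H; apply nd_raa.
  apply (nd_weaken _ _ H), incl_tl, incl_refl.
Qed.

Lemma derives_andI Gam A B :
  derives T Gam A -> derives T Gam B -> derives T Gam (fAnd A B).
Proof. apply derives_nd2; intros G; apply nd_andI. Qed.

Lemma derives_andE1 Gam A B : derives T Gam (fAnd A B) -> derives T Gam A.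
Proof. apply derives_nd1; intros G; apply nd_andE1. Qed.

Lemma derives_andE2 Gam A B : derives T Gam (fAnd A B) -> derives T Gam B.
Proof. apply derives_nd1; intros G; apply nd_andE2. Qed.

Lemma derives_orE Gam A B C :
  derives T Gam (fOr A B) -> derives T (A :: Gam) C -> derives T (B :: Gam) C ->
  derives T Gam C.
Proof.
  (* With the two cases turned into implications, all three premises have the same context and can
     share one list of axioms. *)
  intros H HA HB; apply derives_impI in HA, HB.
  refine (derives_nd2 _ _ _ _ _ H (derives_andI _ _ _ HA HB)).
  intros G HG Himp; apply (nd_orE _ A B C HG).
  - apply (nd_impE _ A); [|now apply nd_hyp; left].
    apply (nd_weaken G); [now apply (nd_andE1 _ _ (fImp B C))|].
    apply incl_tl, incl_refl.
  - apply (nd_impE _ B); [|now apply nd_hyp; left].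
    apply (nd_weaken G); [now apply (nd_andE2 _ (fImp A C))|].
    apply incl_tl, incl_refl.
Qed.

Lemma map_lift_sentences G : (forall B, In B G -> T B) -> map lift G = G.
Proof.
  intros HG; rewrite <- (map_id G) at 2; apply map_ext_in; intros B HB.
  now apply subst_sentence, T_sentences, HG.
Qed.

Lemma derives_allI Gam A :
  derives T (map lift Gam) A -> derives T Gam (fAll A).
Proof.
  intros (G & HG & H); exists G; split; [easy|apply nd_allI].
  now rewrite map_app, (map_lift_sentences G HG).
Qed.

(** The instance is absorbed into a simultaneous substitution, so that repeated eliminations build
    up one [tscons] instead of nested instances. *)
Lemma derives_allE Gam A s t :
  derives T Gam (subst s (fAll A)) -> derives T Gam (subst (tscons t s) A).
Proof.
  rewrite <- inst_up; apply derives_nd1; intros G; apply nd_allE.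
Qed.

Lemma derives_exI Gam A t : derives T Gam (inst A t) -> derives T Gam (fEx A).
Proof. apply derives_nd1; intros G; apply nd_exI. Qed.

Lemma derives_exE Gam A C :
  derives T Gam (fEx A) -> derives T (A :: map lift Gam) (lift C) ->
  derives T Gam C.
Proof.
  intros HA HC; destruct (derives_common _ _ _ _ HA HC) as (G & HG & H1 & H2).
  exists G; split; [easy|apply (nd_exE _ A); [easy|]].
  now rewrite map_app, (map_lift_sentences G HG).
Qed.

Lemma derives_rewrite A Gam t u :
  derives T Gam (fEq t u) -> derives T Gam (inst A t) ->
  derives T Gam (inst A u).
Proof. apply derives_nd2; intros G; apply nd_eq_subst. Qed.

Lemma derives_sym Gam t u : derives T Gam (fEq t u) -> derives T Gam (fEq u t).
Proof.
  intros H.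
  assert (Hinst : forall v, inst (fEq (tVar 0) (lift_term t)) v = fEq v t).
  { intros v; change (fEq v (subst_term (tscons v tVar) (lift_term t)) = fEq v t).
    now rewrite subst_term_tscons_lift, subst_term_var. }
  rewrite <- Hinst; apply (derives_rewrite _ _ _ _ H); rewrite Hinst.
  exists []; split; [easy|apply nd_eq_refl].
Qed.

Lemma derives_lt_rewrite_l Gam t u v :
  derives T Gam (fEq t u) -> derives T Gam (fLt t v) -> derives T Gam (fLt u v).
Proof.
  assert (Hinst : forall w, inst (fLt (tVar 0) (lift_term v)) w = fLt w v).
  { intros w; change (fLt w (subst_term (tscons w tVar) (lift_term v)) = fLt w v).
    now rewrite subst_term_tscons_lift, subst_term_var. }
  rewrite <- !Hinst; apply derives_rewrite.
Qed.

Lemma derives_adjoin A B :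
  proves (adjoin T A) B -> derives T [] (fImp A B).
Proof.
  intros (G & HG & H).
  (* The disjunction in [adjoin] sorts the members of [G]: all uses of [A] collapse into one
     hypothesis, and the rest are axioms of [T]. *)
  assert (HG' : exists G', (forall C, In C G' -> T C) /\ incl G (A :: G')).
  { clear H; induction G as [|C G IH].
    - now exists [].
    - destruct IH as (G' & HT & Hincl); [intros; apply HG; now right|].
      destruct (HG C (or_introl eq_refl)) as [HC| ->].
      + exists (C :: G'); split; [intros D [<-|]; auto|].
        intros D [<-|HD]; [now right; left|].
        destruct (Hincl D HD); [now left|now right; right].
      + exists G'; split; [easy|].
        now apply incl_cons; [left|]. }
  destruct HG' as (G' & HT & Hincl); apply derives_impI; exists G'; split; [easy|].
  exact (nd_weaken _ _ H _ Hincl).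
Qed.

(** * Provable bounds on numerals *)

Fixpoint one_of_numerals (n : nat) : form :=
  match n with
  | 0 => fBot
  | S m => fOr (one_of_numerals m) (fEq (tVar 0) (numeral m))
  end.

Lemma one_of_numerals_Delta0 n : Delta0 (one_of_numerals n).
Proof. induction n; simpl; auto using Delta0. Qed.

Lemma one_of_numerals_fv_below n : fv_below 1 (one_of_numerals n).
Proof. induction n; simpl; auto using numeral_fv_below. Qed.

Lemma sat_one_of_numerals n e : e 0 < n -> sat e (one_of_numerals n).
Proof.
  induction n as [|n IH]; simpl; intros H; [lia|].
  rewrite eval_numeral; destruct (Nat.eq_dec (e 0) n); [now right|left].
  apply IH; lia.
Qed.

Lemma derives_one_of_numerals n Gam C :
  derives T Gam (one_of_numerals n) ->
  (forall a, a < n -> derives T (fEq (tVar 0) (numeral a) :: Gam) C) ->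
  derives T Gam C.
Proof.
  revert Gam; induction n as [|n IH]; simpl; intros Gam H HC.
  { now apply derives_exfalso. }
  apply (derives_orE _ _ _ _ H); [|apply HC; lia].
  apply IH; [now apply derives_hyp; left|].
  intros a Ha; apply (derives_weaken (fEq (tVar 0) (numeral a) :: Gam));
    [apply HC; lia|].
  intros D [<-|HD]; [now left|now right; right].
Qed.

Definition all_below (t : term) (A : form) : form :=
  fAll (fImp (fLt (tVar 0) (lift_term t)) A).

(** The Delta_0 sentence saying that every x below n is one of 0, ..., n - 1 is true, hence
    provable; it splits the bounded quantifier into finitely many numerical cases. *)
Lemma derives_all_below_numeral n C :
  (forall A, sentence A -> Sigma 1 A -> true_in_N A -> proves T A) ->
  fv_below 1 C -> (forall a, a < n -> derives T [] (inst C (numeral a))) ->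
  derives T [] (all_below (numeral n) C).
Proof.
  intros Hcompl HC Hinst; apply derives_allI, derives_impI; simpl.
  apply (derives_one_of_numerals n).
  - assert (Hsent : sentence (all_below (numeral n) (one_of_numerals n))).
    { unfold sentence, all_below, lift_term; simpl; rewrite subst_term_numeral.
      auto using numeral_fv_below, one_of_numerals_fv_below. }
    assert (Hbound : proves T (all_below (numeral n) (one_of_numerals n))).
    { apply Hcompl; [exact Hsent| |].
      - apply Sigma_Pi, Pi_0, D0_all, one_of_numerals_Delta0.
      - intros e a; unfold all_below, lift_term; simpl.
        rewrite subst_term_numeral, eval_numeral.
        apply (sat_one_of_numerals n (scons a e)). }
    apply (derives_impE _ (fLt (tVar 0) (lift_term (numeral n))));
      [|now apply derives_hyp; left].
    (* This identity substitution is written so that [derives_allE] instantiates the lifted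
       universal sentence at variable 0. *)
    rewrite <- (subst_id (fImp _ _) (tscons (tVar 0) shift)) by now intros [|i].
    apply derives_allE, derives_proves.
    fold (all_below (numeral n) (one_of_numerals n)).
    now rewrite subst_sentence.
  - intros a Ha.
    assert (Heq : forall t, inst (subst (up shift) C) t = subst (tscons t shift) C)
      by (intros t; apply inst_up).
    (* [up shift] moves the other variables out of the way, presenting [C] as an instance at
       variable 0; the case equation then reduces it to the instance at the numeral. *)
    replace C with (inst (subst (up shift) C) (tVar 0)).
    + apply (derives_rewrite _ _ (numeral a));
        [now apply derives_sym, derives_hyp; left|].
      rewrite Heq.
      replace (subst _ C) with (inst C (numeral a));
        [now apply (derives_weaken []); [apply Hinst|]|].
      apply (subst_ext_below C 1); [easy|].
      intros [|i] Hi; [easy|lia].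
    + rewrite Heq; apply subst_id; now intros [|i].
Qed.

(** * Order facts from PA^- *)

Hypothesis T_PAminus : forall A, In A PAminus -> proves T A.

(** The identity substitution puts an axiom into the form that [derives_allE] eliminates. *)
Lemma derives_PAminus Gam A : In A PAminus -> derives T Gam (subst tVar A).
Proof. intros H; rewrite subst_id by easy; now apply derives_proves, T_PAminus. Qed.

Ltac PAminus_axiom := apply derives_PAminus; cbv; tauto.

Lemma derives_lt_1_add Gam t :
  derives T Gam (fLt t (tAdd (tSucc tZero) t)).
Proof.
  set (one := tSucc tZero).
  assert (Hmono : derives T Gam (subst tVar (fAll (fAll (fAll
    (fImp (fLt (tVar 0) (tVar 1))
          (fLt (tAdd (tVar 0) (tVar 2)) (tAdd (tVar 1) (tVar 2)))))))))
    by PAminus_axiom.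
  (* The outermost quantifier comes first: z is [t], y is 1 and x is 0, which gives 0 + t < 1 + t
     from 0 < 1. *)
  apply derives_allE with (t := t), derives_allE with (t := one),
    derives_allE with (t := tZero) in Hmono.
  assert (H01 : derives T Gam (subst tVar (fLt tZero one))) by PAminus_axiom.
  assert (Hcomm : derives T Gam (subst tVar (fAll (fAll
    (fEq (tAdd (tVar 0) (tVar 1)) (tAdd (tVar 1) (tVar 0)))))))
    by PAminus_axiom.
  apply derives_allE with (t := t), derives_allE with (t := tZero) in Hcomm.
  assert (H0 : derives T Gam (subst tVar (fAll
    (fEq (tAdd (tVar 0) tZero) (tVar 0))))) by PAminus_axiom.
  apply derives_allE with (t := t) in H0.
  apply (derives_lt_rewrite_l _ _ _ _ H0), (derives_lt_rewrite_l _ _ _ _ Hcomm).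
  exact (derives_impE _ _ _ Hmono H01).
Qed.

Lemma derives_lt_trans Gam t u v :
  derives T Gam (fLt t u) -> derives T Gam (fLt u v) ->
  derives T Gam (fLt t v).
Proof.
  intros Htu Huv.
  assert (H : derives T Gam (subst tVar (fAll (fAll (fAll
    (fImp (fAnd (fLt (tVar 0) (tVar 1)) (fLt (tVar 1) (tVar 2)))
          (fLt (tVar 0) (tVar 2)))))))) by PAminus_axiom.
  apply derives_allE with (t := v), derives_allE with (t := u),
    derives_allE with (t := t) in H.
  exact (derives_impE _ _ _ H (derives_andI _ _ _ Htu Huv)).
Qed.

Lemma derives_lt_trichotomy Gam t u :
  derives T Gam (fOr (fLt t u) (fOr (fEq t u) (fLt u t))).
Proof.
  assert (H : derives T Gam (subst tVar (fAll (fAll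
    (fOr (fLt (tVar 0) (tVar 1))
         (fOr (fEq (tVar 0) (tVar 1)) (fLt (tVar 1) (tVar 0))))))))
    by PAminus_axiom.
  apply derives_allE with (t := u), derives_allE with (t := t) in H.
  exact H.
Qed.

(** By trichotomy one of the terms is at least the other, and 1 plus that term lies strictly above
    both. *)
Lemma derives_common_upper_bound Gam t u :
  derives T Gam
    (fEx (fAnd (fLt (lift_term t) (tVar 0)) (fLt (lift_term u) (tVar 0)))).
Proof.
  set (one := tSucc tZero).
  assert (Hex : forall Gam v, derives T Gam (fLt t v) -> derives T Gam (fLt u v) ->
    derives T Gam
      (fEx (fAnd (fLt (lift_term t) (tVar 0)) (fLt (lift_term u) (tVar 0))))).
  { intros Gam' v Ht Hu; apply (derives_exI _ _ v).
    change (derives T Gam' (fAnd (fLt (subst_term (tscons v tVar) (lift_term t)) v)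
      (fLt (subst_term (tscons v tVar) (lift_term u)) v))).
    rewrite !subst_term_tscons_lift, !subst_term_var.
    now apply derives_andI. }
  apply (derives_orE _ _ _ _ (derives_lt_trichotomy Gam t u));
    [|eapply derives_orE; [now apply derives_hyp; left| |]].
  - apply (Hex _ (tAdd one u)); [|apply derives_lt_1_add].
    apply (derives_lt_trans _ _ u); [|apply derives_lt_1_add].
    now apply derives_hyp; left.
  - apply (Hex _ (tAdd one t)); [apply derives_lt_1_add|].
    apply (derives_lt_rewrite_l _ t); [|apply derives_lt_1_add].
    now apply derives_hyp; left.
  - apply (Hex _ (tAdd one t)); [apply derives_lt_1_add|].
    apply (derives_lt_trans _ _ t); [|apply derives_lt_1_add].
    now apply derives_hyp; left.
Qed.

(** * Bounding a universal block *)

(** Indices 0 and 1 are the inner bound and the block variable y; index 2 is freed for the new outer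
    bound w of [bound_all]. *)
Definition insert_third (n : nat) : term :=
  match n with
  | 0 => tVar 0
  | 1 => tVar 1
  | S (S m) => tVar (S (S (S m)))
  end.

(* If variable 0 of [B] bounds the block that follows (forall y), then
   variable 0 of [bound_all B] bounds both [y] and that inner bound. Using a
   fresh inner bound avoids having to prove that [B] is monotone in it. *)
Definition bound_all (B : form) : form :=
  all_below (tVar 0) (all_below (tVar 1) (subst insert_third B)).

Lemma bound_all_fv_below k B :
  fv_below (S (S k)) B -> fv_below (S k) (bound_all B).
Proof.
  intros HB; simpl; repeat split; try lia.
  apply (subst_fv_below _ _ _ _ HB); intros [|[|n]] Hn; simpl; lia.
Qed.

Lemma derives_bound_all_elim Gam B s w t v :
  derives T Gam (subst s (fAll (bound_all B))) ->
  derives T Gam (fLt t w) -> derives T Gam (fLt v w) ->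
  derives T Gam (subst (tscons v (tscons t s)) B).
Proof.
  intros H Ht Hv.
  apply derives_allE with (t := w), derives_allE with (t := t) in H.
  apply derives_impE with (2 := Ht), derives_allE with (t := v) in H.
  apply derives_impE with (2 := Hv) in H.
  revert H; rewrite subst_comp.
  match goal with |- derives T Gam ?X -> derives T Gam ?Y => replace X with Y end;
    [easy|].
  apply subst_ext; now intros [|[|n]].
Qed.

(** Given y and an inner bound m, choose w above both: the hypothesis at w yields B(m, y).
    Generalizing over m gives the premise from which [A] follows at y. *)
Lemma derives_all_from_bound_all A B :
  derives T [fAll B] A -> derives T [fAll (bound_all B)] (fAll A).
Proof.
  intros HA; apply derives_allI.
  apply (derives_impE _ (fAll B)).
  { apply derives_impI, (derives_weaken _ _ _ HA); now intros C [<-|[]]; left. }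
  apply derives_allI.
  apply (derives_exE _ _ _ (derives_common_upper_bound _ (tVar 1) (tVar 0))).
  match goal with |- derives T ?G _ => set (Gam := G) end.
  assert (Hex : derives T Gam (fAnd (fLt (tVar 2) (tVar 0)) (fLt (tVar 1) (tVar 0))))
    by now apply derives_hyp; left.
  (* Variables 0, 1 and 2 are now w, the inner bound and y, so the hypothesis has been lifted three
     times. *)
  assert (Hall : derives T Gam
    (subst (fun n => tVar (3 + n)) (fAll (bound_all B)))).
  { apply derives_hyp; right; left.
    unfold lift; rewrite !subst_comp; now apply subst_ext. }
  apply derives_bound_all_elim with (w := tVar 0) (t := tVar 2) (v := tVar 1)
    in Hall.
  - revert Hall; unfold lift.
    match goal with |- derives T Gam ?X -> derives T Gam ?Y => replace X with Y end;
      [easy|].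
    apply subst_ext; now intros [|[|n]].
  - exact (derives_andE1 _ _ _ Hex).
  - exact (derives_andE2 _ _ _ Hex).
Qed.

(** * Bounded forms of true Pi_2 and Sigma_3 formulas *)

Hypothesis T_Sigma1_complete :
  forall A, sentence A -> Sigma 1 A -> true_in_N A -> proves T A.

(** Once w is a numeral, both bounded quantifiers have numerical bounds and reduce in turn to
    instances of [B] at numerals. *)
Lemma derives_bound_all_numeral B e n :
  (forall a m, derives T [] (subst (numerals (scons m (scons a e))) B)) ->
  derives T [] (subst (numerals (scons n e)) (bound_all B)).
Proof.
  intros HB; set (s := numerals (scons n e)).
  assert (Hbody : forall s' i, s' i = numeral n ->
    up s' (S i) = lift_term (numeral n)).
  { intros s' i Hi; simpl; now rewrite Hi. }
  set (C := subst (up s) (all_below (tVar 1) (subst insert_third B))).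
  change (derives T [] (all_below (numeral n) C)).
  apply derives_all_below_numeral; [easy|apply subst_up_numerals_fv_below|].
  intros a _; unfold C; rewrite inst_up.
  set (s1 := tscons (numeral a) s).
  change (derives T [] (all_below (numeral n) (subst (up s1) (subst insert_third B)))).
  apply derives_all_below_numeral; [easy| |].
  - replace (subst (up s1) _) with
      (subst (up (numerals (scons a (scons n e)))) (subst insert_third B));
      [apply subst_up_numerals_fv_below|].
    apply subst_ext; now intros [|[|i]].
  - intros m _; rewrite inst_up, subst_comp.
    specialize (HB a m); revert HB.
    match goal with |- derives T _ ?X -> derives T _ ?Y => replace X with Y end;
      [easy|].
    apply subst_ext; now intros [|[|i]].
Qed.

(** Induction on the universal block. A Sigma_1 matrix gets a dummy bound, and its true instances
    are provable by completeness; each further quantifier is handled by [bound_all]. The assignment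
    stays arbitrary because that step extends it. *)
Lemma Pi2_bounded_form A :
  Pi 2 A -> exists B,
    (forall k, fv_below k A -> fv_below (S k) B) /\
    (forall e n, sat e A -> derives T [] (subst (numerals (scons n e)) B)) /\
    derives T [fAll B] A.
Proof.
  remember 2 as two eqn:Htwo; intros H; revert Htwo.
  induction H as [A HA|m A HA|m A HA IH]; intros Htwo; [easy| |].
  - injection Htwo as ->; exists (lift A); split; [|split].
    + intros k Hk; apply (subst_fv_below _ k); [easy|]; simpl; lia.
    + intros e n HAe.
      replace (subst _ _) with (subst (numerals e) A)
        by (unfold lift; rewrite subst_comp; now apply subst_ext).
      apply T_Sigma1_complete.
      * apply subst_numerals_sentence.
      * now apply Sigma_Pi_subst.
      * now apply true_subst_numerals.
  + assert (H : derives T [fAll (lift A)] (subst tVar (fAll (lift A))))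
      by (rewrite subst_id by easy; now apply derives_hyp; left).
    (* Zero is an arbitrary choice: the quantified variable does not occur in [lift A]. *)
    apply derives_allE with (t := tZero) in H.
    now change (derives T [fAll (lift A)] (inst (lift A) tZero)) in H;
      rewrite inst_lift in H.
  - destruct (IH Htwo) as (B & Hfv & Hinst & HB).
    exists (bound_all B); split; [|split].
    + intros k Hk; apply bound_all_fv_below, Hfv, Hk.
    + intros e n HAe; apply derives_bound_all_numeral.
      intros a m'; apply Hinst, HAe.
    + now apply derives_all_from_bound_all.
Qed.

(** Truth supplies a witness for each leading existential quantifier. It is recorded in [e], and its
    numeral proves the quantifier back on the way out. *)
Lemma true_Sigma3_bounded_form A :
  Sigma 3 A -> forall e, sat e A -> exists B,
    fv_below 1 B /\
    (forall n, derives T [] (inst B (numeral n))) /\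
    derives T [fAll B] (subst (numerals e) A).
Proof.
  remember 3 as three eqn:Hthree; intros H; revert Hthree.
  induction H as [A HA|m A HA|m A HA IH]; intros Hthree e HAe; [easy| |].
  - injection Hthree as ->.
    (* The Pi_2 core is closed first, so that only the bound remains free in [B]. *)
    destruct (Pi2_bounded_form (subst (numerals e) A)) as (B & Hfv & Hinst & HB).
    { now apply Sigma_Pi_subst. }
    assert (HB1 : fv_below 1 B) by apply Hfv, subst_numerals_sentence.
    exists B; split; [|split]; [easy| |easy].
    intros n; replace (inst B (numeral n)) with
      (subst (numerals (scons n (fun _ => 0))) B).
    + now apply Hinst, true_subst_numerals.
    + apply (subst_ext_below B 1); [easy|]; intros [|i] Hi; [easy|lia].
  - destruct HAe as [a HAe]; destruct (IH Hthree _ HAe) as (B & HB1 & Hinst & HB).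
    exists B; split; [|split]; [easy|easy|].
    apply (derives_exI _ _ (numeral a)); rewrite inst_up.
    replace (subst _ A) with (subst (numerals (scons a e)) A); [easy|].
    apply subst_ext; now intros [|i].
Qed.

End Derives.

Theorem theorem2p4 (P T : form -> Prop) (hP : base_theory P)
  (hT : theory_over P T) (hTomega : omega_consistent T)
  (sigma : form) (hsent : sentence sigma) (hSigma3 : Sigma 3 sigma)
  (htrue : true_in_N sigma) :
  omega_consistent (adjoin T sigma) /\
  omega_inconsistent (adjoin T (fNot sigma)).
Proof.
  destruct hP as [_ _ hPA hS1], hT as [hTs hPT].
  assert (hmono : forall A, proves P A -> proves T A)
    by (intros A (G & HG & H); exists G; auto).
  destruct (true_Sigma3_bounded_form T hTs (fun A H => hmono A (hPA A H))
    (fun A H1 H2 H3 => hmono A (hS1 A H1 H2 H3)) sigma hSigma3 (fun _ => 0)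
    (htrue _)) as (B & HB1 & Hinst & HB).
  rewrite subst_sentence in HB by easy; split.
  - intros (phi & Hphi1 & Hnall & Hphi); apply hTomega.
    apply derives_adjoin in Hnall.
    set (psi := fAnd B (fImp sigma phi)).
    assert (Hpsi1 : fv_below 1 psi).
    { simpl; repeat split; [easy| |easy].
      rewrite <- (subst_sentence sigma tVar hsent).
      apply (subst_fv_below _ 0); [easy|lia]. }
    exists psi; split; [easy|split].
    (* From all psi(x) follow all B(x), hence sigma, hence all phi(x); but sigma refutes the last
       over [T]. *)
    + change (derives T [] (fNot (fAll psi))); apply derives_impI.
      assert (Hall : forall s, subst s (fAll psi) = fAll psi)
        by (intros s; now apply subst_sentence).
      assert (Hlift : map lift [fAll psi] = [fAll psi])
        by (unfold lift; cbn [map]; now rewrite Hall).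
      assert (Hpsi : derives T [fAll psi] psi).
      { rewrite <- (subst_id psi (tscons (tVar 0) shift)) at 2 by now intros [|i].
        apply derives_allE, derives_hyp; left; now rewrite Hall. }
      assert (Hsigma : derives T [fAll psi] sigma).
      { apply (derives_impE _ _ (fAll B)).
        - apply derives_impI, (derives_weaken _ _ _ _ HB).
          now intros C [<-|[]]; left.
        - apply derives_allI; [easy|]; rewrite Hlift.
          now apply (derives_andE1 _ _ _ (fImp sigma phi)). }
      apply (derives_impE _ _ (fAll phi)).
      { apply (derives_impE _ _ sigma); [|easy].
        now apply (derives_weaken _ []). }
      apply derives_allI; [easy|]; rewrite Hlift.
      apply (derives_impE _ _ sigma); [|easy].
      now apply (derives_andE2 _ _ B).
    (* The second conjunct comes from the deduction theorem, since instantiation leaves the sentence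
       [sigma] unchanged. *)
    + intros n; apply (derives_andI T [] (inst B (numeral n))); [apply Hinst|].
      specialize (Hphi n); apply derives_adjoin in Hphi.
      change (derives T [] (fImp (inst sigma (numeral n)) (inst phi (numeral n)))).
      unfold inst at 1; now rewrite subst_sentence.
  - assert (hadj : forall A, derives T [] A -> proves (adjoin T (fNot sigma)) A)
      by (intros A (G & HG & H); exists G; split; [now left; auto|easy]).
    (* [B] itself is the witness: its instances are already provable in [T], and its generalization
       would give [sigma]. *)
    exists B; split; [easy|split]; [|intros n; apply hadj, Hinst].
    destruct HB as (G & HG & HB).
    exists (fNot sigma :: G); split.
    + intros C [<-|HC]; [now right|left; auto].
    + apply nd_impI, (nd_impE _ sigma).
      * apply nd_hyp; right; now left.
      * apply (nd_weaken _ _ HB); intros C [<-|HC]; [now left|now right; right].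
Qed.
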